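(* For every $\mathsf{xSKSg}$ proof of size $n$ there exists an $\mathsf{xFrege}$ proof of the same formula whose length and size are respectively $O(n^4)$ and $O(n^5)$.
   Context: CoS: formulae built from units $\mathsf f,\mathsf t$, atoms $a,\bar a,\dots$, formula variables $A,\bar A,\dots$ by $[\alpha\vee\beta]$ and $(\alpha\wedge\beta)$; $\bar\cdot$ involution on atoms and on variables with $\bar a\ne a$, $\bar A\ne A$; the De Morgan dual $\bar\alpha$ exchanges $\vee/\wedge$, $\mathsf t/\mathsf f$ and negates atoms and variables. Equality $=$ is the smallest context-closed equivalence containing commutativity and associativity of $\vee,\wedge$, $[\alpha\vee\mathsf f]=\alpha$, $(\alpha\wedge\mathsf t)=\alpha$, $[\mathsf t\vee\mathsf t]=\mathsf t$, $(\mathsf f\wedge\mathsf f)=\mathsf f$. A rule $\alpha/\beta$ has instances $\alpha\rho\sigma/\beta\rho\sigma$ (renaming $\rho$ of atoms, substitution $\sigma$ of formulae for variables, $\bar A\mapsto$ dual) and generates steps $\xi\{\gamma\}/\xi\{\delta\}$ for any context (formula with one hole) $\xi$. A derivation in $\mathcal S$ from premiss $\alpha_0$ to conclusion $\alpha_k$ is a chain alternating $=$-steps and steps generated by rules of $\mathcal S$; size = number of occurrences of units, atoms, variables. $\mathsf{SKSg}$ has the rules $\mathsf t/[A\vee\bar A]$, $(A\wedge\bar A)/\mathsf f$, $\mathsf f/A$, $A/\mathsf t$, $[A\vee A]/A$, $A/(A\wedge A)$, $(A\wedge[B\vee C])/[(A\wedge B)\vee C]$. $\mathsf{xSKSg}$: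 an extended $\mathsf{SKSg}$ proof of $\alpha$ is an $\mathsf{SKSg}$ derivation with conclusion $\alpha$ and premiss $([\bar A_1\vee\beta_1]\wedge[\bar\beta_1\vee A_1]\wedge\dots\wedge[\bar A_h\vee\beta_h]\wedge[\bar\beta_h\vee A_h])$, where $A_1,\bar A_1,\dots,A_h,\bar A_h$ are mutually distinct variables and, for each $i$, neither $A_i$ nor $\bar A_i$ occurs in $\beta_1,\dots,\beta_i,\alpha$. $\mathsf{Frege}$: formulae over $\mathsf t,\mathsf f$, non-negated variables, $\vee,\wedge,\to,\neg$; axiom schemes $F_1: A\to(B\to(A\wedge B))$; $F_2:(A\wedge B)\to A$; $F_3:(A\wedge B)\to B$; $F_4:A\to(A\vee B)$; $F_5:B\to(A\vee B)$; $F_6:\neg\neg A\to A$; $F_7:A\to\neg\neg A$; $F_8:A\to(B\to A)$; $F_9:\neg A\to(A\to B)$; $F_{10}:(A\to(B\to C))\to((A\to B)\to(A\to C))$; $F_{11}:(A\to C)\to((B\to C)\to((A\vee B)\to C))$; $F_{12}:(A\to(B\to C))\to(B\to(A\to C))$; $F_{13}:(A\to B)\to(\neg B\to\neg A)$; $F_{14}:\mathsf f\to(A\wedge\neg A)$; $F_{15}:(A\wedge\neg A)\to\mathsf f$; $F_{16}:\mathsf t\to(A\vee\neg A)$; $F_{17}:(A\vee\neg A)\to\mathsf t$ (instances by substituting formulae), and modus ponens. $\mathsf{xFrege}$: a proof is a sequence $\alpha_1,\dots,\alpha_k$ (conclusion $\alpha_k$) in which each formula is an axiom instance, follows by modus ponens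 from earlier formulae, or is an extension instance $A\leftrightarrow\beta$ (shorthand for $((A\to\beta)\wedge(\beta\to A))$) with the variable $A$ not occurring in any earlier formula, in $\beta$, or in $\alpha_k$; length = number of formulae; size = number of occurrences of units and variables. Translation: atoms/variables ↔ Frege variables, negated atoms/variables ↔ $\neg$ of variables, $\neg\alpha$ ↔ dual, $\alpha\to\beta$ ↔ $[\bar\alpha\vee\beta]$. *)

(* Defs.v *)
From mathcomp Require Import all_boot.

Set Implicit Arguments.
Unset Strict Implicit.
Unset Printing Implicit Defensive.

(** * Calculus of structures *)

(* A literal is a name with a polarity; flipping the polarity is the
   fixpoint-free involution.  Literals serve both as the atoms and as the
   formula variables; the two kinds are kept apart by the constructors of
   [cform]. *)
Definition literal : Type := (nat * bool)%type.

Definition neg (x : literal) : literal := (x.1, ~~ x.2).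

Inductive cform : Type :=
| CFalse
| CTrue
| CAtom of literal
| CVar of literal
| COr of cform & cform
| CAnd of cform & cform.

Declare Scope cos_scope.
Delimit Scope cos_scope with cos.
Bind Scope cos_scope with cform.
Notation "a || b" := (COr a b) : cos_scope.
Notation "a && b" := (CAnd a b) : cos_scope.

Fixpoint dual (a : cform) : cform :=
  match a with
  | CFalse => CTrue
  | CTrue => CFalse
  | CAtom x => CAtom (neg x)
  | CVar x => CVar (neg x)
  | COr a b => dual a && dual b
  | CAnd a b => dual a || dual b
  end%cos.

Fixpoint csize (a : cform) : nat :=
  match a with
  | CFalse | CTrue | CAtom _ | CVar _ => 1
  | COr a b | CAnd a b => csize a + csize b
  end.

Fixpoint cvar_occurs (x : literal) (a : cform) : bool :=
  match a with
  | CVar y => x == y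
  | COr a b | CAnd a b => cvar_occurs x a || cvar_occurs x b
  | _ => false
  end.

Inductive context : Type :=
| Hole
| OrL of context & cform
| OrR of cform & context
| AndL of context & cform
| AndR of cform & context.

Fixpoint plug (xi : context) (a : cform) : cform :=
  match xi with
  | Hole => a
  | OrL xi b => plug xi a || b
  | OrR b xi => b || plug xi a
  | AndL xi b => plug xi a && b
  | AndR b xi => b && plug xi a
  end%cos.

Inductive ceq : cform -> cform -> Prop :=
| ceq_orC a b : ceq (a || b) (b || a)
| ceq_andC a b : ceq (a && b) (b && a)
| ceq_orA a b c : ceq ((a || b) || c) (a || (b || c))
| ceq_andA a b c : ceq ((a && b) && c) (a && (b && c))
| ceq_orF a : ceq (a || CFalse) a
| ceq_andT a : ceq (a && CTrue) a
| ceq_orTT : ceq (CTrue || CTrue) CTrue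
| ceq_andFF : ceq (CFalse && CFalse) CFalse
| ceq_refl a : ceq a a
| ceq_sym a b : ceq a b -> ceq b a
| ceq_trans a b c : ceq a b -> ceq b c -> ceq a c
| ceq_context xi a b : ceq a b -> ceq (plug xi a) (plug xi b).

Definition is_renaming (rho : literal -> literal) : Prop :=
  forall x, rho (neg x) = neg (rho x).

Definition is_subst (sigma : literal -> cform) : Prop :=
  forall x, sigma (neg x) = dual (sigma x).

Fixpoint rename (rho : literal -> literal) (a : cform) : cform :=
  match a with
  | CAtom x => CAtom (rho x)
  | COr a b => rename rho a || rename rho b
  | CAnd a b => rename rho a && rename rho b
  | _ => a
  end%cos.

Fixpoint subst (sigma : literal -> cform) (a : cform) : cform :=
  match a with
  | CVar x => sigma x
  | COr a b => subst sigma a || subst sigma b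
  | CAnd a b => subst sigma a && subst sigma b
  | _ => a
  end%cos.

(* [S a b] means that the rule with premiss [a] and conclusion [b] is in [S]. *)
Definition system : Type := cform -> cform -> Prop.

Inductive rule_instance (S : system) : cform -> cform -> Prop :=
| RuleInstance a b rho sigma :
    S a b -> is_renaming rho -> is_subst sigma ->
    rule_instance S (subst sigma (rename rho a)) (subst sigma (rename rho b)).

Inductive rule_step (S : system) : cform -> cform -> Prop :=
| RuleStep xi c d : rule_instance S c d -> rule_step S (plug xi c) (plug xi d).

(* The boolean tells whether the first step of the chain, if there is one, is
   an equality step ([true]) or a rule step ([false]). *)
Inductive alternating (S : system) : bool -> seq cform -> Prop :=
| alternating_one k a : alternating S k [:: a]
| alternating_eq a b s :
    ceq a b -> alternating S false (b :: s) -> alternating S true (a :: b :: s)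
| alternating_rule a b s :
    rule_step S a b -> alternating S true (b :: s) ->
    alternating S false (a :: b :: s).

Definition derivation (S : system) (premiss conclusion : cform)
    (d : seq cform) : Prop :=
  [/\ exists k, alternating S k d,
      head CTrue d = premiss & last CTrue d = conclusion].

Definition derivation_size (d : seq cform) : nat := \sum_(a <- d) csize a.

Definition varA : cform := CVar (0, true).
Definition varB : cform := CVar (1, true).
Definition varC : cform := CVar (2, true).

Inductive SKSg : cform -> cform -> Prop :=
| identity : SKSg CTrue (varA || dual varA)
| cut : SKSg (varA && dual varA) CFalse
| weakening : SKSg CFalse varA
| coweakening : SKSg varA CTrue
| contraction : SKSg (varA || varA) varA
| cocontraction : SKSg varA (varA && varA)
| switch : SKSg (varA && (varB || varC)) ((varA && varB) || varC).

(* Nested to the right; the empty conjunction is the unit [CTrue]. *)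
Fixpoint conjunction (s : seq cform) : cform :=
  match s with
  | [::] => CTrue
  | [:: a] => a
  | a :: s' => a && conjunction s'
  end%cos.

(* The list [e] holds the pairs (A_1, beta_1), ..., (A_h, beta_h). *)
Definition extension_premiss (e : seq (literal * cform)) : cform :=
  conjunction (flatten
    [seq [:: CVar (neg x.1) || x.2; dual x.2 || CVar x.1]%cos | x <- e]).

Definition cvar_fresh (x : literal) (a : cform) : bool :=
  ~~ cvar_occurs x a && ~~ cvar_occurs (neg x) a.

Definition extension_ok (e : seq (literal * cform)) (a : cform) : Prop :=
  let A i := (nth ((0, true), CTrue) e i).1 in
  let beta i := (nth ((0, true), CTrue) e i).2 in
  [/\ uniq (flatten [seq [:: x.1; neg x.1] | x <- e]),
      forall i j, j <= i -> i < size e -> cvar_fresh (A i) (beta j)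
    & forall i, i < size e -> cvar_fresh (A i) a].

Definition xSKSg_proof (a : cform) (d : seq cform) : Prop :=
  exists2 e, extension_ok e a & derivation SKSg (extension_premiss e) a d.

(** * Frege systems *)

(* [inl] and [inr] are the Frege variables corresponding to the names of the
   atoms and of the formula variables of [cform], respectively. *)
Definition fvar : Type := (nat + nat)%type.

Inductive fform : Type :=
| FTrue
| FFalse
| FVar of fvar
| FOr of fform & fform
| FAnd of fform & fform
| FImp of fform & fform
| FNot of fform.

Declare Scope frege_scope.
Delimit Scope frege_scope with frege.
Bind Scope frege_scope with fform.
Notation "a || b" := (FOr a b) : frege_scope.
Notation "a && b" := (FAnd a b) : frege_scope.
Notation "a ==> b" := (FImp a b) : frege_scope.
Notation "~~ a" := (FNot a) : frege_scope.

Definition FIff (a b : fform) : fform := ((a ==> b) && (b ==> a))%frege.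

Fixpoint fsize (a : fform) : nat :=
  match a with
  | FTrue | FFalse | FVar _ => 1
  | FOr a b | FAnd a b | FImp a b => fsize a + fsize b
  | FNot a => fsize a
  end.

Fixpoint fvar_occurs (x : fvar) (a : fform) : bool :=
  match a with
  | FTrue | FFalse => false
  | FVar y => x == y
  | FOr a b | FAnd a b | FImp a b => fvar_occurs x a || fvar_occurs x b
  | FNot a => fvar_occurs x a
  end.

Inductive frege_axiom : fform -> Prop :=
| F1 A B : frege_axiom (A ==> (B ==> (A && B)))
| F2 A B : frege_axiom ((A && B) ==> A)
| F3 A B : frege_axiom ((A && B) ==> B)
| F4 A B : frege_axiom (A ==> (A || B))
| F5 A B : frege_axiom (B ==> (A || B))
| F6 A : frege_axiom ((~~ ~~ A) ==> A)
| F7 A : frege_axiom (A ==> (~~ ~~ A))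
| F8 A B : frege_axiom (A ==> (B ==> A))
| F9 A B : frege_axiom ((~~ A) ==> (A ==> B))
| F10 A B C :
    frege_axiom ((A ==> (B ==> C)) ==> ((A ==> B) ==> (A ==> C)))
| F11 A B C :
    frege_axiom ((A ==> C) ==> ((B ==> C) ==> ((A || B) ==> C)))
| F12 A B C : frege_axiom ((A ==> (B ==> C)) ==> (B ==> (A ==> C)))
| F13 A B : frege_axiom ((A ==> B) ==> ((~~ B) ==> (~~ A)))
| F14 A : frege_axiom (FFalse ==> (A && ~~ A))
| F15 A : frege_axiom ((A && ~~ A) ==> FFalse)
| F16 A : frege_axiom (FTrue ==> (A || ~~ A))
| F17 A : frege_axiom ((A || ~~ A) ==> FTrue).

Definition modus_ponens (earlier : seq fform) (b : fform) : Prop :=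
  exists i j, [/\ i < size earlier, j < size earlier &
    nth FTrue earlier j = FImp (nth FTrue earlier i) b].

Definition extension_instance (earlier : seq fform) (conclusion b : fform)
    : Prop :=
  exists (x : fvar) (beta : fform),
    [/\ b = FIff (FVar x) beta,
        all (fun c => ~~ fvar_occurs x c) earlier,
        ~~ fvar_occurs x beta
      & ~~ fvar_occurs x conclusion].

Definition xFrege_proof (a : fform) (p : seq fform) : Prop :=
  [/\ 0 < size p, last FTrue p = a &
    forall i, i < size p ->
      [\/ frege_axiom (nth FTrue p i),
          modus_ponens (take i p) (nth FTrue p i)
        | extension_instance (take i p) a (nth FTrue p i)]].

Definition frege_size (p : seq fform) : nat := \sum_(a <- p) fsize a.

(** * Translation *)

Definition to_frege_literal (x : fvar) (polarity : bool) : fform :=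
  if polarity then FVar x else FNot (FVar x).

Fixpoint to_frege (a : cform) : fform :=
  match a with
  | CFalse => FFalse
  | CTrue => FTrue
  | CAtom x => to_frege_literal (inl x.1) x.2
  | CVar x => to_frege_literal (inr x.1) x.2
  | COr a b => to_frege a || to_frege b
  | CAnd a b => to_frege a && to_frege b
  end%frege.

(* Main.v *)
(* Every formula of an xSKSg derivation is handled by Frege implications
   between translations.  Rule instances under a context cost linearly many
   lines, by induction on the substituted formulae (identity and cut) and on the
   context.  An equality step passes through a normal form: flatten nested
   disjunctions and conjunctions, drop neutral units, and turn every operand
   list into a sorted duplicate-free list.  This is coarser than [ceq] but
   Frege proves a formula of size [n] equivalent to its normal form in O(n^3)
   lines of size O(n), all intermediate formulae being no larger than the
   original one.  Each lemma uses its hypotheses once, so tree-like proofs do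
   not blow up; the extension instances, listed first, serve as the only
   hypotheses and give the clauses of the premiss. *)

From HB Require Import structures.
Require Import Defs.
From mathcomp Require Import all_boot zify.

Set Implicit Arguments.
Unset Strict Implicit.
Unset Printing Implicit Defensive.

(** * Normal forms for the equality of formulae *)

(** Generic trees supply the countable structure on formulae; the resulting [pickle] is the
    arbitrary total order by which operands are sorted. *)
Fixpoint cform_encode (a : cform) : GenTree.tree literal :=
  match a with
  | CFalse => GenTree.Node 0 [::]
  | CTrue => GenTree.Node 1 [::]
  | CAtom x => GenTree.Node 2 [:: GenTree.Leaf x]
  | CVar x => GenTree.Node 3 [:: GenTree.Leaf x]
  | COr a b => GenTree.Node 4 [:: cform_encode a; cform_encode b]
  | CAnd a b => GenTree.Node 5 [:: cform_encode a; cform_encode b]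
  end.

Fixpoint cform_decode (t : GenTree.tree literal) : option cform :=
  match t with
  | GenTree.Node 0 [::] => Some CFalse
  | GenTree.Node 1 [::] => Some CTrue
  | GenTree.Node 2 [:: GenTree.Leaf x] => Some (CAtom x)
  | GenTree.Node 3 [:: GenTree.Leaf x] => Some (CVar x)
  | GenTree.Node 4 [:: s; t] =>
      if (cform_decode s, cform_decode t) is (Some a, Some b)
      then Some (COr a b) else None
  | GenTree.Node 5 [:: s; t] =>
      if (cform_decode s, cform_decode t) is (Some a, Some b)
      then Some (CAnd a b) else None
  | _ => None
  end.

Lemma cform_encodeK : pcancel cform_encode cform_decode.
Proof. by elim=> //= a -> b ->. Qed.

HB.instance Definition _ := Countable.copy cform (pcan_type cform_encodeK).

(* The boolean selects the connective: [true] is disjunction, [false] is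
   conjunction; [cunit] is the corresponding neutral unit. *)
Definition cop (b : bool) : cform -> cform -> cform := if b then COr else CAnd.
Definition cunit (b : bool) : cform := if b then CFalse else CTrue.

Fixpoint big_cop (b : bool) (s : seq cform) : cform :=
  match s with
  | [::] => cunit b
  | [:: x] => x
  | x :: s' => cop b x (big_cop b s')
  end.

Fixpoint operands (b : bool) (a : cform) : seq cform :=
  match a with
  | COr x y => if b then operands b x ++ operands b y else [:: a]
  | CAnd x y => if b then [:: a] else operands b x ++ operands b y
  | CFalse => if b then [::] else [:: a]
  | CTrue => if b then [:: a] else [::]
  | _ => [:: a]
  end.

Definition cform_le (x y : cform) : bool := pickle x <= pickle y.

(** Removing duplicates makes both connectives idempotent, which covers [ceq_orTT] and
    [ceq_andFF]. *)
Definition sorted_set (s : seq cform) : seq cform := sort cform_le (undup s).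

Definition norm_op (b : bool) (x y : cform) : cform :=
  big_cop b (sorted_set (operands b x ++ operands b y)).

Fixpoint normalize (a : cform) : cform :=
  match a with
  | COr x y => norm_op true (normalize x) (normalize y)
  | CAnd x y => norm_op false (normalize x) (normalize y)
  | _ => a
  end.

Lemma mem_sorted_set s : sorted_set s =i s.
Proof. by move=> x; rewrite mem_sort mem_undup. Qed.

(** Injectivity of [pickle] makes [cform_le] antisymmetric, so a duplicate-free sorted list is
    determined by its set of members. *)
Lemma eq_sorted_set s t : s =i t -> sorted_set s = sorted_set t.
Proof.
move=> st; apply/perm_sortP; last exact: perm_undup.
- by move=> x y; apply: leq_total.
- by move=> y x z; apply: leq_trans.
by move=> x y /anti_leq/(pcan_inj pickleK).
Qed.

Definition indecomposable (b : bool) (z : cform) : bool := operands b z == [:: z].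

Lemma operands_indecomposable b x : all (indecomposable b) (operands b x).
Proof.
elim: x b => [||l|l|x IHx y IHy|x IHx y IHy] [] //=;
by rewrite ?all_cat ?IHx ?IHy //= andbT /indecomposable.
Qed.

Lemma operands_big_cop b s : all (indecomposable b) s -> operands b (big_cop b s) = s.
Proof.
elim: s => [|x [|y s] IHs]; first by case: b.
  by rewrite /= andbT => /eqP.
move=> /andP[/eqP xP /IHs {}IHs].
have -> : big_cop b [:: x, y & s] = cop b x (big_cop b (y :: s)) by [].
by case: b xP IHs => /= -> ->.
Qed.

(** The invariant of [normalize]: it ensures that a formula is rebuilt exactly from its operand
    list, whichever connective is used to decompose it. *)
Inductive normal : cform -> Prop :=
| normal_atom l : normal (CAtom l)
| normal_var l : normal (CVar l)
| normal_unit b : normal (cunit b)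
| normal_big b x y s :
    (forall z, z \in [:: x, y & s] -> normal z) ->
    all (indecomposable b) [:: x, y & s] ->
    sorted_set [:: x, y & s] = [:: x, y & s] ->
    normal (big_cop b [:: x, y & s]).

Lemma big_cop2 b x y s : big_cop b [:: x, y & s] = cop b x (big_cop b (y :: s)).
Proof. by []. Qed.

Lemma normal_operands b x :
  normal x -> [/\ sorted_set (operands b x) = operands b x,
    big_cop b (operands b x) = x & forall z, z \in operands b x -> normal z].
Proof.
case=> {x} [l|l|b'|b' x y s sN sI sS].
- by split=> // z; rewrite inE => /eqP->; constructor.
- by split=> // z; rewrite inE => /eqP->; constructor.
- case: b; case: b'; split=> //= z; rewrite inE // => /eqP->;
  by [apply: (normal_unit true) | apply: (normal_unit false)].
(* For the same connective the list is recovered; for the other one the whole formula is a single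
   operand. *)
have [<-|bN] := eqVneq b' b; first by rewrite operands_big_cop.
have -> : operands b (big_cop b' [:: x, y & s]) = [:: big_cop b' [:: x, y & s]].
  by rewrite big_cop2; case: b b' bN {sI} => [] [].
by split=> // z; rewrite inE => /eqP->; constructor.
Qed.

Lemma normal_big_cop b s : (forall z, z \in s -> normal z) ->
  all (indecomposable b) s -> sorted_set s = s -> normal (big_cop b s).
Proof.
case: s => [|x [|y s]] sN sI sS; first by case: b {sI};
  [apply: (normal_unit true) | apply: (normal_unit false)].
  by apply: sN; rewrite inE.
by constructor.
Qed.

Lemma all_sorted_set p s : all p (sorted_set s) = all p s.
Proof. exact: eq_all_r (mem_sorted_set s) p. Qed.

Lemma operands_norm_op b x y :
  operands b (norm_op b x y) = sorted_set (operands b x ++ operands b y).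
Proof.
by rewrite operands_big_cop // all_sorted_set all_cat !operands_indecomposable.
Qed.

Lemma normal_norm_op b x y : normal x -> normal y -> normal (norm_op b x y).
Proof.
move=> /(normal_operands b)[_ _ xN] /(normal_operands b)[_ _ yN].
apply: normal_big_cop.
- by move=> z; rewrite mem_sorted_set mem_cat => /orP[/xN|/yN].
- by rewrite all_sorted_set all_cat !operands_indecomposable.
exact/eq_sorted_set/mem_sorted_set.
Qed.

Lemma normal_normalize a : normal (normalize a).
Proof.
elim: a => [||l|l|x IHx y IHy|x IHx y IHy] /=; try exact: normal_norm_op;
by [constructor | apply: (normal_unit true) | apply: (normal_unit false)].
Qed.

Lemma norm_opC b x y : norm_op b x y = norm_op b y x.
Proof. by congr big_cop; apply: eq_sorted_set => z; rewrite !mem_cat orbC. Qed.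

(** Since [operands] recovers the sorted list from a normal form, both sides are built from the same
    set of operands. *)
Lemma norm_opA b x y z :
  norm_op b (norm_op b x y) z = norm_op b x (norm_op b y z).
Proof.
rewrite {1 3}/norm_op !operands_norm_op; congr big_cop.
by apply: eq_sorted_set => t; rewrite !(mem_cat, mem_sorted_set) orbA.
Qed.

Lemma norm_op_unit b x : normal x -> norm_op b x (cunit b) = x.
Proof.
move=> /(normal_operands b)[xS xB _]; rewrite -[RHS]xB -[in RHS]xS.
by congr big_cop; congr sorted_set; case: b {xS xB}; rewrite /= cats0.
Qed.

(** Each generator is an algebraic law of [norm_op], and contexts are respected because [normalize]
    is computed from the normal forms of the immediate subformulae. *)
Lemma normalize_ceq a b : ceq a b -> normalize a = normalize b.
Proof.
elim=> {a b} //=; try by move=> *; apply: norm_opC.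
- by move=> *; apply: norm_opA.
- by move=> *; apply: norm_opA.
- by move=> a; apply: (norm_op_unit true (normal_normalize a)).
- by move=> a; apply: (norm_op_unit false (normal_normalize a)).
- by move=> a b c _ -> _ ->.
by move=> xi a b _ eq_ab; elim: xi => //= [xi -> c|c xi ->|xi -> c|c xi ->].
Qed.

(** * Sizes of operand lists and normal forms *)

Definition csizes (s : seq cform) : nat := sumn (map csize s).

Lemma csize_gt0 a : 0 < csize a.
Proof. by elim: a => //= *; lia. Qed.

Lemma csizes_cons x s : csizes (x :: s) = csize x + csizes s.
Proof. by []. Qed.

Lemma size_csizes s : size s <= csizes s.
Proof. by elim: s => //= x s; have := csize_gt0 x; rewrite /csizes /=; lia. Qed.

Lemma csize_mem x s : x \in s -> csize x <= csizes s.
Proof.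
by elim: s => //= y s IHs; rewrite inE /csizes /= => /orP[/eqP->|/IHs];
  rewrite /csizes; lia.
Qed.

Lemma csize_cop b x y : csize (cop b x y) = csize x + csize y.
Proof. by case: b. Qed.

(** The [maxn 1] accounts for the empty list, which yields a unit. *)
Lemma csize_big_cop b s : csize (big_cop b s) <= maxn 1 (csizes s).
Proof.
elim: s => [|x [|y s] IHs]; first by case: b.
  by rewrite /csizes /=; lia.
rewrite big_cop2 csize_cop; have := csize_gt0 y.
by rewrite /csizes /= in IHs *; lia.
Qed.

Lemma csizes_cat s t : csizes (s ++ t) = csizes s + csizes t.
Proof. by rewrite /csizes map_cat sumn_cat. Qed.

Lemma csizes_operands b a : csizes (operands b a) <= csize a.
Proof.
elim: a b => [||l|l|x IHx y IHy|x IHx y IHy] [] //=;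
by [rewrite csizes_cat leq_add | rewrite /csizes /= addn0].
Qed.

Lemma csizes_sorted_set s : csizes (sorted_set s) <= csizes s.
Proof.
rewrite /csizes (perm_sumn (perm_map csize (permEl (perm_sort _ _)))).
elim: s => //= x s IHs; case: ifP => _ /=; lia.
Qed.

Lemma csize_norm_op b x y : csize (norm_op b x y) <= csize x + csize y.
Proof.
have := csize_big_cop b (sorted_set (operands b x ++ operands b y)).
have := csizes_sorted_set (operands b x ++ operands b y).
have := csizes_operands b x; have := csizes_operands b y; have := csize_gt0 x.
rewrite csizes_cat /norm_op; lia.
Qed.

Lemma csize_normalize a : csize (normalize a) <= csize a.
Proof.
elim: a => //= x IHx y IHy;
by apply: leq_trans (csize_norm_op _ _ _) _; apply: leq_add.
Qed.
(** * Frege provability with explicit costs *)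

(* Tree-like derivability from the formulae listed in [E]: [w] bounds the size
   of every formula and [l] the number of nodes. *)
Inductive provable (E : seq fform) (w : nat) : nat -> fform -> Prop :=
| provable_axiom a : frege_axiom a -> fsize a <= w -> provable E w 1 a
| provable_hyp i :
    i < size E -> fsize (nth FTrue E i) <= w -> provable E w 1 (nth FTrue E i)
| provable_mp l1 l2 a b :
    provable E w l1 (a ==> b) -> provable E w l2 a -> provable E w (l1 + l2).+1 b
| provable_le l l' a : provable E w l a -> l <= l' -> provable E w l' a.

Ltac by_axiom := apply: provable_axiom; [by constructor | rewrite /=; lia].

Lemma provable_fsize E w l a : provable E w l a -> fsize a <= w.
Proof. by elim=> //= l1 l2 x y _ + _ _; lia. Qed.

Lemma provable_const E w l x a :
  2 * (fsize x + fsize a) <= w -> provable E w l a -> provable E w (l + 2) (x ==> a).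
Proof.
move=> hw pa; have ax : provable E w 1 (a ==> (x ==> a)) by by_axiom.
by apply: provable_le (provable_mp ax pa) _; lia.
Qed.

Lemma provable_app E w l1 l2 x a b :
  4 * (fsize x + fsize a + fsize b) <= w ->
  provable E w l1 (x ==> (a ==> b)) -> provable E w l2 (x ==> a) ->
  provable E w (l1 + l2 + 3) (x ==> b).
Proof.
move=> hw pab pa.
have ax : provable E w 1 ((x ==> (a ==> b)) ==> ((x ==> a) ==> (x ==> b))) by by_axiom.
by apply: provable_le (provable_mp (provable_mp ax pab) pa) _; lia.
Qed.

Lemma provable_trans E w l1 l2 a b c :
  4 * (fsize a + fsize b + fsize c) <= w ->
  provable E w l1 (a ==> b) -> provable E w l2 (b ==> c) ->
  provable E w (l1 + l2 + 5) (a ==> c).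
Proof.
move=> hw pab pbc.
have pabc : provable E w (l2 + 2) (a ==> (b ==> c)).
  by apply: provable_const pbc => /=; lia.
by apply: provable_le (provable_app _ pabc pab) _; lia.
Qed.

(** Composes the two double-negation axioms [F7] and [F6]. *)
Lemma provable_refl E w a : 12 * fsize a <= w -> provable E w 7 (a ==> a).
Proof.
move=> hw.
have p : provable E w 1 (a ==> ~~ ~~ a) by by_axiom.
have q : provable E w 1 ((~~ ~~ a) ==> a) by by_axiom.
by apply: provable_trans p q => /=; lia.
Qed.

Lemma provable_pair E w l1 l2 x a b :
  16 * (fsize x + fsize a + fsize b) <= w ->
  provable E w l1 (x ==> a) -> provable E w l2 (x ==> b) ->
  provable E w (l1 + l2 + 9) (x ==> (a && b)).
Proof.
move=> hw pa pb.
have ax : provable E w 1 (a ==> (b ==> (a && b))) by by_axiom.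
have p : provable E w (l1 + 1 + 5) (x ==> (b ==> (a && b))).
  by apply: provable_trans pa ax => /=; lia.
by apply: provable_le (provable_app _ p pb) _; rewrite /=; lia.
Qed.

(** [F10] turns the constant implication [b ==> ((a && b) ==> c)] into a map from [b ==> (a && b)],
    which [F1] obtains from [a]. *)
Lemma provable_curry E w l a b c :
  16 * (fsize a + fsize b + fsize c) <= w ->
  provable E w l ((a && b) ==> c) -> provable E w (l + 14) (a ==> (b ==> c)).
Proof.
move=> hw pc.
have pbc : provable E w (l + 2) (b ==> ((a && b) ==> c)).
  by apply: provable_const pc => /=; lia.
have ax : provable E w 1
  ((b ==> ((a && b) ==> c)) ==> ((b ==> (a && b)) ==> (b ==> c))) by by_axiom.
have ax' : provable E w 1 (a ==> (b ==> (a && b))) by by_axiom.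
apply: provable_le (provable_trans _ ax' (provable_mp ax pbc)) _ => /=; lia.
Qed.

Lemma provable_uncurry E w l a b c :
  16 * (fsize a + fsize b + fsize c) <= w ->
  provable E w l (a ==> (b ==> c)) -> provable E w (l + 14) ((a && b) ==> c).
Proof.
move=> hw pc.
have pa : provable E w 1 ((a && b) ==> a) by by_axiom.
have pb : provable E w 1 ((a && b) ==> b) by by_axiom.
have pbc : provable E w (1 + l + 5) ((a && b) ==> (b ==> c)).
  by apply: provable_trans pa pc => /=; lia.
by apply: provable_le (provable_app _ pbc pb) _ => /=; lia.
Qed.

Lemma provable_cases E w l1 l2 a b c :
  4 * (fsize a + fsize b + fsize c) <= w ->
  provable E w l1 (a ==> c) -> provable E w l2 (b ==> c) ->
  provable E w (l1 + l2 + 3) ((a || b) ==> c).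
Proof.
move=> hw pa pb.
have ax : provable E w 1 ((a ==> c) ==> ((b ==> c) ==> ((a || b) ==> c))) by by_axiom.
by apply: provable_le (provable_mp (provable_mp ax pa) pb) _; lia.
Qed.

Lemma provable_and E w l1 l2 a b :
  4 * (fsize a + fsize b) <= w ->
  provable E w l1 a -> provable E w l2 b -> provable E w (l1 + l2 + 3) (a && b).
Proof.
move=> hw pa pb.
have ax : provable E w 1 (a ==> (b ==> (a && b))) by by_axiom.
by apply: provable_le (provable_mp (provable_mp ax pa) pb) _; lia.
Qed.

Lemma provable_orC E w a b :
  16 * (fsize a + fsize b) <= w -> provable E w 5 ((a || b) ==> (b || a)).
Proof.
move=> hw.
have pa : provable E w 1 (a ==> (b || a)) by by_axiom.
have pb : provable E w 1 (b ==> (b || a)) by by_axiom.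
by apply: provable_le (provable_cases _ pa pb) _ => /=; lia.
Qed.

Lemma provable_andC E w a b :
  32 * (fsize a + fsize b) <= w -> provable E w 11 ((a && b) ==> (b && a)).
Proof.
move=> hw.
have pa : provable E w 1 ((a && b) ==> a) by by_axiom.
have pb : provable E w 1 ((a && b) ==> b) by by_axiom.
by apply: provable_le (provable_pair _ pb pa) _ => /=; lia.
Qed.

Lemma provable_false E w a : 16 * (fsize a + 1) <= w -> provable E w 7 (FFalse ==> a).
Proof.
move=> hw.
have p : provable E w 1 (FFalse ==> (a && ~~ a)) by by_axiom.
have q : provable E w 1 ((a && ~~ a) ==> a) by by_axiom.
by apply: provable_trans p q => /=; lia.
Qed.

Lemma provable_true E w a : 16 * (fsize a + 1) <= w -> provable E w 7 (a ==> FTrue).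
Proof.
move=> hw.
have p : provable E w 1 (a ==> (a || ~~ a)) by by_axiom.
have q : provable E w 1 ((a || ~~ a) ==> FTrue) by by_axiom.
by apply: provable_trans p q => /=; lia.
Qed.

Lemma provable_FTrue E w : 64 <= w -> provable E w 10 FTrue.
Proof.
move=> hw.
(* [FTrue] is not an axiom; it is detached from an implication whose premiss is some axiom instance,
   here one of [F8]. *)
have p : provable E w 1 (FFalse ==> (FFalse ==> FFalse)) by by_axiom.
by apply: provable_le (provable_mp (provable_true _ _) p) _ => /=; lia.
Qed.

Lemma provable_excluded_middle E w a : 64 * (fsize a + 1) <= w -> provable E w 12 (a || ~~ a).
Proof.
move=> hw.
have ax : provable E w 1 (FTrue ==> (a || ~~ a)) by by_axiom.
by apply: provable_le (provable_mp ax (provable_FTrue _ _)) _ => /=; lia.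
Qed.

Lemma provable_or_swap E w l a b :
  16 * (fsize a + fsize b) <= w -> provable E w l (a || b) -> provable E w (l + 6) (b || a).
Proof.
by move=> hw p; apply: provable_le (provable_mp (provable_orC _ hw) p) _; lia.
Qed.

Lemma provable_imp_or E w l1 l2 a a' b :
  16 * (fsize a + fsize a' + fsize b) <= w ->
  provable E w l1 (a || a') -> provable E w l2 (a ==> b) ->
  provable E w (l1 + l2 + 11) (a' || b).
Proof.
move=> hw p q.
have i1 : provable E w 1 (b ==> (a' || b)) by by_axiom.
have i2 : provable E w 1 (a' ==> (a' || b)) by by_axiom.
have c1 : provable E w (l2 + 1 + 5) (a ==> (a' || b)).
  by apply: provable_trans q i1 => /=; lia.
have c2 : provable E w (l2 + 1 + 5 + 1 + 3) ((a || a') ==> (a' || b)).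
  by apply: provable_cases c1 i2 => /=; lia.
by apply: provable_le (provable_mp c2 p) _; lia.
Qed.

(** With [a] moved to the right by currying, the case analysis on [b || c] has the goal [a ==> d] in
    both branches; uncurrying then restores the conjunction. *)
Lemma provable_switch E w a b c :
  128 * (fsize a + fsize b + fsize c) <= w ->
  provable E w 100 ((a && (b || c)) ==> ((a && b) || c)).
Proof.
move=> hw; set d := ((a && b) || c)%frege.
have hd : fsize d = fsize a + fsize b + fsize c by [].
have i1 : provable E w 1 ((a && b) ==> d) by by_axiom.
have i2 : provable E w 1 (c ==> d) by by_axiom.
have p1 : provable E w (11 + 1 + 5) ((b && a) ==> d).
  by apply: provable_trans (provable_andC _ _) i1 => /=; lia.
have p2 : provable E w (11 + 1 + 5 + 14) (b ==> (a ==> d)).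
  by apply: provable_curry p1; lia.
have i3 : provable E w 1 (d ==> (a ==> d)) by by_axiom.
have p3 : provable E w (1 + 1 + 5) (c ==> (a ==> d)).
  by apply: provable_trans i2 i3 => /=; lia.
have p4 := provable_cases (c := (a ==> d)%frege) _ p2 p3.
have {}p4 := p4 ltac:(rewrite /=; lia).
have p5 : provable E w _ (((b || c) && a) ==> d) := provable_uncurry _ p4.
have {}p5 := p5 ltac:(rewrite /=; lia).
by apply: provable_le (provable_trans _ (provable_andC _ _) p5) _ => /=; lia.
Qed.

(** * Monotonicity and lattice operations *)

(** For [b = false] the order is reversed, so that [fop b] is the join for [fle b] in both cases and
    one argument serves disjunction and conjunction. *)
Definition fop (b : bool) : fform -> fform -> fform := if b then FOr else FAnd.
Definition fle (b : bool) (x y : fform) : fform :=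
  (if b then x ==> y else y ==> x)%frege.

Lemma fsize_fop b x y : fsize (fop b x y) = fsize x + fsize y.
Proof. by case: b. Qed.

Lemma fle_refl E w b x : 12 * fsize x <= w -> provable E w 7 (fle b x x).
Proof. by case: b; apply: provable_refl. Qed.

Lemma fle_trans E w l1 l2 b x y z :
  4 * (fsize x + fsize y + fsize z) <= w ->
  provable E w l1 (fle b x y) -> provable E w l2 (fle b y z) ->
  provable E w (l1 + l2 + 5) (fle b x z).
Proof.
case: b => hw p q; first exact: provable_trans p q.
by rewrite (addnC l1); apply: provable_trans q p; lia.
Qed.

Lemma fle_inl E w b x y : 4 * (fsize x + fsize y) <= w -> provable E w 1 (fle b x (fop b x y)).
Proof. by case: b => hw; by_axiom. Qed.

Lemma fle_inr E w b x y : 4 * (fsize x + fsize y) <= w -> provable E w 1 (fle b y (fop b x y)).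
Proof. by case: b => hw; by_axiom. Qed.

Lemma fle_join E w l1 l2 b x y z :
  16 * (fsize x + fsize y + fsize z) <= w ->
  provable E w l1 (fle b x z) -> provable E w l2 (fle b y z) ->
  provable E w (l1 + l2 + 9) (fle b (fop b x y) z).
Proof.
case: b => hw p q; last by apply: provable_pair p q; lia.
by apply: provable_le (provable_cases _ p q) _; lia.
Qed.

Lemma fle_mono E w l1 l2 b x x' y y' :
  16 * (fsize x + fsize x' + fsize y + fsize y') <= w ->
  provable E w l1 (fle b x x') -> provable E w l2 (fle b y y') ->
  provable E w (l1 + l2 + 21) (fle b (fop b x y) (fop b x' y')).
Proof.
move=> hw p q.
have pl : provable E w (l1 + 1 + 5) (fle b x (fop b x' y')).
  by apply: fle_trans p (fle_inl _ _ _); rewrite ?fsize_fop; lia.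
have pr : provable E w (l2 + 1 + 5) (fle b y (fop b x' y')).
  by apply: fle_trans q (fle_inr _ _ _); rewrite ?fsize_fop; lia.
by apply: provable_le (fle_join _ pl pr) _; rewrite ?fsize_fop; lia.
Qed.

Lemma imp_mono E w l1 l2 b x x' y y' :
  16 * (fsize x + fsize x' + fsize y + fsize y') <= w ->
  provable E w l1 (x ==> x') -> provable E w l2 (y ==> y') ->
  provable E w (l1 + l2 + 21) (fop b x y ==> fop b x' y').
Proof.
case: b => hw p q; first exact: (fle_mono (b := true)).
by apply: (fle_mono (b := false)) => //; lia.
Qed.

(** * Equivalence of a formula with its normal form *)

Lemma fsize_to_frege a : fsize (to_frege a) = csize a.
Proof. by elim: a => [||[n []]|[n []]|x IHx y IHy|x IHx y IHy] //=; rewrite IHx IHy. Qed.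

Lemma csize_dual a : csize (dual a) = csize a.
Proof. by elim: a => //= x -> y ->. Qed.

Lemma to_frege_cop b x y : to_frege (cop b x y) = fop b (to_frege x) (to_frege y).
Proof. by case: b. Qed.

Lemma cunit_fle E w b a :
  16 * (csize a + 1) <= w -> provable E w 7 (fle b (to_frege (cunit b)) (to_frege a)).
Proof.
by case: b => hw; [apply: provable_false | apply: provable_true]; rewrite fsize_to_frege.
Qed.

(** An iterated join lies below every common upper bound of its operands; the bound on the unit
    handles the empty list. *)
Lemma big_cop_fle E w l b s z :
  64 * (csizes s + fsize z + 1) <= w ->
  provable E w 7 (fle b (to_frege (cunit b)) z) ->
  (forall x, x \in s -> provable E w l (fle b (to_frege x) z)) ->
  provable E w (7 + size s * (l + 9)) (fle b (to_frege (big_cop b s)) z).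
Proof.
move=> hw pu; elim: s hw => [|x [|y s] IHs] hw ps; first by apply: provable_le pu _.
  by apply: provable_le (ps x (mem_head _ _)) _; rewrite /=; lia.
have px := ps x (mem_head _ _).
have {}IHs := IHs _ (fun u us => ps u (mem_behead (s := _ :: _) us)).
have {}IHs : provable E w (7 + size (y :: s) * (l + 9)) 
    (fle b (to_frege (big_cop b (y :: s))) z).
  by apply: IHs; rewrite /csizes /= in hw *; lia.
rewrite big_cop2 to_frege_cop.
apply: provable_le (fle_join _ px IHs) _; rewrite ?fsize_to_frege; last by rewrite /=; nia.
by have := csize_big_cop b (y :: s); have := csize_gt0 y; rewrite /csizes /= in hw *; lia.
Qed.

Lemma mem_fle_big_cop E w b s x :
  64 * (csizes s + 1) <= w -> x \in s ->
  provable E w (7 + size s * 9) (fle b (to_frege x) (to_frege (big_cop b s))).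
Proof.
elim: s => [//|y [|y' s] IHs] hw.
  rewrite inE => /eqP->; apply: provable_le (fle_refl _ _ _) _ => //.
  by rewrite fsize_to_frege; rewrite /csizes /= in hw; lia.
have hs := csize_big_cop b (y' :: s); have h0 := csize_gt0 y'.
rewrite big_cop2 to_frege_cop; move: (big_cop b (y' :: s)) hs IHs => t hs IHs.
rewrite !csizes_cons in hw hs IHs; rewrite in_cons => /orP[/eqP->|xs].
  by apply: provable_le (fle_inl _ _ _) _; rewrite ?fsize_to_frege; lia.
have hx := csize_mem xs; rewrite csizes_cons in hx.
have {}IHs := IHs _ xs.
by apply: provable_le (fle_trans _ (IHs _) (fle_inr _ _ _)) _;
  rewrite ?fsize_fop ?fsize_to_frege /=; lia.
Qed.

Definition frege_equiv E w l x y : Prop :=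
  provable E w l (x ==> y) /\ provable E w l (y ==> x).

Lemma frege_equiv_fle E w l b x y :
  provable E w l (fle b x y) -> provable E w l (fle b y x) -> frege_equiv E w l x y.
Proof. by case: b. Qed.

(** Both sides are joins of the same operands. Normality makes [x] and [y] the joins of their own
    operand lists, so each inequality reduces to single operands: at most [n] of them, at a linear
    cost each. *)
Lemma norm_op_equiv E w n b x y : normal x -> normal y ->
  csize x + csize y <= n -> 256 * n <= w ->
  frege_equiv E w (100 * n ^ 2) (to_frege (norm_op b x y)) (to_frege (cop b x y)).
Proof.
move=> /(normal_operands b)[_ xB _] /(normal_operands b)[_ yB _] hn hw.
have x0 := csize_gt0 x; have y0 := csize_gt0 y.
have hN : csize (norm_op b x y) <= n by apply: leq_trans (csize_norm_op b x y) hn.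
have hx := csizes_operands b x; have hy := csizes_operands b y.
have sx := size_csizes (operands b x); have sy := size_csizes (operands b y).
have hs : csizes (sorted_set (operands b x ++ operands b y)) <= n.
  by apply: leq_trans (csizes_sorted_set _) _; rewrite csizes_cat; lia.
have ss := size_csizes (sorted_set (operands b x ++ operands b y)).
apply: (@frege_equiv_fle _ _ _ b).
  (* The value of [l] is the cost of placing an operand below [x] or [y], plus 6 for composing with
     one injection. *)
  apply: provable_le (big_cop_fle (l := 7 + n * 9 + 6) _ _ _) _.
  - by rewrite fsize_to_frege csize_cop; lia.
  - by apply: cunit_fle; rewrite csize_cop; lia.
  - move=> z; rewrite mem_sorted_set mem_cat to_frege_cop => /orP[] zs.
      have hz := csize_mem zs.
      have p := @mem_fle_big_cop E w b (operands b x) z _ zs.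
      rewrite xB in p; apply: provable_le (fle_trans _ (p _) (fle_inl _ _ _)) _;
        rewrite ?fsize_fop ?fsize_to_frege; nia.
    have hz := csize_mem zs.
    have p := @mem_fle_big_cop E w b (operands b y) z _ zs.
    rewrite yB in p; apply: provable_le (fle_trans _ (p _) (fle_inr _ _ _)) _;
      rewrite ?fsize_fop ?fsize_to_frege; nia.
  by nia.
have mem_le u : u \in operands b x ++ operands b y ->
    provable E w (7 + n * 9) (fle b (to_frege u) (to_frege (norm_op b x y))).
  rewrite -mem_sorted_set => us.
  by apply: provable_le (@mem_fle_big_cop E w b _ u _ us) _; nia.
have unit_le := @cunit_fle E w b (norm_op b x y).
have px := @big_cop_fle E w (7 + n * 9) b (operands b x) (to_frege (norm_op b x y)).
have py := @big_cop_fle E w (7 + n * 9) b (operands b y) (to_frege (norm_op b x y)).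
rewrite xB fsize_to_frege in px; rewrite yB fsize_to_frege in py.
rewrite to_frege_cop; apply: provable_le (fle_join _ (px _ _ _) (py _ _ _)) _.
- by rewrite !fsize_to_frege; lia.
- by lia.
- by apply: unit_le; lia.
- by move=> z zs; apply: mem_le; rewrite mem_cat zs.
- by lia.
- by apply: unit_le; lia.
- by move=> z zs; apply: mem_le; rewrite mem_cat zs orbT.
by nia.
Qed.

(** The factor [(2 * csize a).-1] is the number of nodes of the binary tree with [csize a] leaves;
    each node is charged [200 * n ^ 2]. *)
Lemma normalize_equiv E w n a : csize a <= n -> 256 * n <= w ->
  frege_equiv E w ((2 * csize a).-1 * (200 * n ^ 2))
    (to_frege a) (to_frege (normalize a)).
Proof.
move=> han hw; have n0 : 0 < n by apply: leq_trans (csize_gt0 a) han.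
have h0 x : csize x = 1 ->
    frege_equiv E w ((2 * csize x).-1 * (200 * n ^ 2)) (to_frege x) (to_frege x).
  move=> x1; split; apply: provable_le (provable_refl _ _) _; rewrite ?fsize_to_frege x1; nia.
have hop b x y :
    csize x + csize y <= n ->
    frege_equiv E w ((2 * csize x).-1 * (200 * n ^ 2)) (to_frege x) (to_frege (normalize x)) ->
    frege_equiv E w ((2 * csize y).-1 * (200 * n ^ 2)) (to_frege y) (to_frege (normalize y)) ->
    frege_equiv E w ((2 * (csize x + csize y)).-1 * (200 * n ^ 2)) (to_frege (cop b x y))
      (to_frege (norm_op b (normalize x) (normalize y))).
  move=> hxy [px qx] [py qy].
  have nx := csize_normalize x; have ny := csize_normalize y.
  have no := csize_norm_op b (normalize x) (normalize y).
  have [] := @norm_op_equiv E w n b _ _ (normal_normalize x) (normal_normalize y) _ hw.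
    by lia.
  have x0 := csize_gt0 x; have y0 := csize_gt0 y.
  rewrite !to_frege_cop => pN qN.
  split.
    apply: provable_le (provable_trans _ (imp_mono b _ px py) qN) _;
      rewrite ?fsize_fop ?fsize_to_frege; nia.
  apply: provable_le (provable_trans _ pN (imp_mono b _ qx qy)) _;
    rewrite ?fsize_fop ?fsize_to_frege; nia.
elim: a han => [||l|l|x IHx y IHy|x IHx y IHy] han; try exact: h0.
  by apply: (hop true x y han); [apply: IHx | apply: IHy]; rewrite /= in han; lia.
by apply: (hop false x y han); [apply: IHx | apply: IHy]; rewrite /= in han; lia.
Qed.

Lemma provable_ceq E w n a b : ceq a b -> csize a <= n -> csize b <= n ->
  256 * n <= w -> provable E w (1000 * n ^ 3) (to_frege a ==> to_frege b).
Proof.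
move=> /normalize_ceq ab an bn hw.
have [p _] := normalize_equiv E an hw; have [_ q] := normalize_equiv E bn hw.
rewrite -ab in q.
have hN := csize_normalize a; have a0 := csize_gt0 a.
apply: provable_le (provable_trans _ p q) _; rewrite ?fsize_to_frege; first by lia.
have -> : n ^ 3 = n * n ^ 2 by rewrite expnS.
have : 0 < n ^ 2 by rewrite expn_gt0; lia.
by nia.
Qed.

(** * Derivation steps *)

Lemma csize_plug xi c : csize c <= csize (plug xi c).
Proof. by elim: xi => //= *; lia. Qed.

(** Each level of the context costs 28: 21 for monotonicity and 7 for reflexivity of the side
    formula, whose size is at least 1. *)
Lemma provable_plug E w l xi c d :
  32 * (csize (plug xi c) + csize (plug xi d)) <= w ->
  provable E w l (to_frege c ==> to_frege d) ->
  provable E w (l + 28 * csize (plug xi c))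
    (to_frege (plug xi c) ==> to_frege (plug xi d)).
Proof.
move=> hw p.
have prefl b : 12 * csize b <= w -> provable E w 7 (to_frege b ==> to_frege b).
  by move=> hb; apply: provable_refl; rewrite fsize_to_frege.
elim: xi hw => [|xi IH b|b xi IH|xi IH b|b xi IH] /= hw.
- by apply: provable_le p _; lia.
all: have b0 := csize_gt0 b.
- apply: provable_le (imp_mono true _ (IH _) (prefl b _)) _; rewrite ?fsize_to_frege; lia.
- apply: provable_le (imp_mono true _ (prefl b _) (IH _)) _; rewrite ?fsize_to_frege; lia.
- apply: provable_le (imp_mono false _ (IH _) (prefl b _)) _; rewrite ?fsize_to_frege; lia.
- apply: provable_le (imp_mono false _ (prefl b _) (IH _)) _; rewrite ?fsize_to_frege; lia.
Qed.

(** Nested case analysis: first on [y || y'] with goal [x ==> d], then on [x || x'] with goal [d],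
    where [d] is the conclusion. [F12] exchanges the two curried premisses. *)
Lemma excluded_middle_and E w l1 l2 x x' y y' :
  128 * (fsize x + fsize x' + fsize y + fsize y') <= w ->
  provable E w l1 (x || x') -> provable E w l2 (y || y') ->
  provable E w (l1 + l2 + 70) ((x && y) || (x' || y')).
Proof.
move=> hw px py; set d := (_ || _)%frege.
have hd : fsize d = fsize x + fsize y + (fsize x' + fsize y') by [].
have i1 : provable E w 1 ((x && y) ==> d) by by_axiom.
have i2 : provable E w 1 ((x' || y') ==> d) by by_axiom.
have i3 : provable E w 1 (x' ==> (x' || y')) by by_axiom.
have i4 : provable E w 1 (y' ==> (x' || y')) by by_axiom.
have i5 : provable E w 1 (d ==> (x ==> d)) by by_axiom.
have i6 : provable E w 1 ((x ==> (y ==> d)) ==> (y ==> (x ==> d))) by by_axiom.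
have xd : provable E w (1 + 1 + 5) (x' ==> d) by apply: provable_trans i3 i2; rewrite /=; lia.
have yd : provable E w (1 + 1 + 5) (y' ==> d) by apply: provable_trans i4 i2; rewrite /=; lia.
have yxd : provable E w (1 + 1 + 5 + 1 + 5) (y' ==> (x ==> d)).
  by apply: provable_trans yd i5; rewrite /=; lia.
have xyd : provable E w (1 + 14) (x ==> (y ==> d)) by apply: provable_curry i1; lia.
have c1 : provable E w ((1 + (1 + 14)).+1 + (1 + 1 + 5 + 1 + 5) + 3)
    ((y || y') ==> (x ==> d)).
  by apply: provable_cases (provable_mp i6 xyd) yxd; rewrite /=; lia.
have := provable_cases _ (provable_mp c1 py) xd => c2.
by apply: provable_le (provable_mp (c2 _) px) _; rewrite /=; lia.
Qed.

(** Projecting [x' && y'] to the relevant conjunct refutes each disjunct of [x || y]; currying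
    allows the two refutations to be joined by cases. *)
Lemma contradiction_and E w l1 l2 x x' y y' :
  128 * (fsize x + fsize x' + fsize y + fsize y' + 1) <= w ->
  provable E w l1 ((x && x') ==> FFalse) -> provable E w l2 ((y && y') ==> FFalse) ->
  provable E w (l1 + l2 + 115) (((x || y) && (x' && y')) ==> FFalse).
Proof.
move=> hw px py.
have refl z : 12 * fsize z <= w -> provable E w 7 (z ==> z) by apply: provable_refl.
have i1 : provable E w 1 ((x' && y') ==> x') by by_axiom.
have i2 : provable E w 1 ((x' && y') ==> y') by by_axiom.
have m1 : provable E w (7 + 1 + 21) ((x && (x' && y')) ==> (x && x')).
  by apply: (imp_mono false) i1; rewrite /=; [lia | apply: refl; lia].
have m2 : provable E w (7 + 1 + 21) ((y && (x' && y')) ==> (y && y')).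
  by apply: (imp_mono false) i2; rewrite /=; [lia | apply: refl; lia].
have n1 : provable E w (7 + 1 + 21 + l1 + 5 + 14) (x ==> ((x' && y') ==> FFalse)).
  by apply: provable_curry (provable_trans _ m1 px); rewrite /=; lia.
have n2 : provable E w (7 + 1 + 21 + l2 + 5 + 14) (y ==> ((x' && y') ==> FFalse)).
  by apply: provable_curry (provable_trans _ m2 py); rewrite /=; lia.
by apply: provable_le (provable_uncurry _ (provable_cases _ n1 n2)) _; rewrite /=; lia.
Qed.

(** Counting tree nodes leaves a slack of 100 at every connective, enough for [excluded_middle_and]
    and, for a disjunction, for the swaps that exchange the formula with its dual. *)
Lemma provable_or_dual E w a :
  256 * csize a <= w ->
  provable E w (100 * (2 * csize a).-1) (to_frege a || to_frege (dual a)).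
Proof.
have lit x b : 256 <= w ->
    provable E w 100 (to_frege_literal x b || to_frege_literal x (~~ b)).
  move=> hw; have p := @provable_excluded_middle E w (FVar x).
  case: b => /=; first by apply: provable_le (p _) _; rewrite /=; lia.
  by apply: provable_le (provable_or_swap _ (p _)) _; rewrite /=; lia.
elim: a => [||[k b]|[k b]|x IHx y IHy|x IHx y IHy] /= hw.
- have ax : provable E w 1 (FTrue ==> (FFalse || FTrue)) by by_axiom.
  by apply: provable_le (provable_mp ax (provable_FTrue _ _)) _; lia.
- have ax : provable E w 1 (FTrue ==> (FTrue || FFalse)) by by_axiom.
  by apply: provable_le (provable_mp ax (provable_FTrue _ _)) _; lia.
- by rewrite muln1; apply: lit; lia.
- by rewrite muln1; apply: lit; lia.
all: have x0 := csize_gt0 x; have y0 := csize_gt0 y.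
- have px := provable_or_swap _ (IHx _); have py := provable_or_swap _ (IHy _).
  rewrite !fsize_to_frege !csize_dual in px py.
  apply: provable_le (provable_or_swap _ (excluded_middle_and _ (px _ _) (py _ _))) _;
    rewrite /= ?fsize_to_frege ?csize_dual; lia.
apply: provable_le (excluded_middle_and _ (IHx _) (IHy _)) _;
  rewrite ?fsize_to_frege ?csize_dual; lia.
Qed.

Lemma provable_and_dual E w a :
  512 * csize a <= w ->
  provable E w (200 * (2 * csize a).-1) ((to_frege a && to_frege (dual a)) ==> FFalse).
Proof.
have lit x b : 512 <= w ->
    provable E w 200 ((to_frege_literal x b && to_frege_literal x (~~ b)) ==> FFalse).
  move=> hw; have p : provable E w 1 ((FVar x && ~~ FVar x) ==> FFalse) by by_axiom.
  case: b => /=; first by apply: provable_le p _.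
  by apply: provable_le (provable_trans _ (provable_andC _ _) p) _; rewrite /=; lia.
elim: a => [||[k b]|[k b]|x IHx y IHy|x IHx y IHy] /= hw.
- have ax : provable E w 1 ((FFalse && FTrue) ==> FFalse) by by_axiom.
  by apply: provable_le ax _.
- have ax : provable E w 1 ((FTrue && FFalse) ==> FFalse) by by_axiom.
  by apply: provable_le ax _.
- by rewrite muln1; apply: lit; lia.
- by rewrite muln1; apply: lit; lia.
all: have x0 := csize_gt0 x; have y0 := csize_gt0 y.
- apply: provable_le (contradiction_and _ (IHx _) (IHy _)) _;
    rewrite ?fsize_to_frege ?csize_dual; lia.
have comm z : 128 * csize z <= w ->
    provable E w 11 ((to_frege (dual z) && to_frege z) ==> (to_frege z && to_frege (dual z))).
  by move=> hz; apply: provable_andC; rewrite !fsize_to_frege csize_dual; lia.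
have px := provable_trans _ (comm x _) (IHx _).
have py := provable_trans _ (comm y _) (IHy _).
rewrite /= !fsize_to_frege !csize_dual in px py.
apply: provable_le (provable_trans _ (provable_andC _ _)
  (contradiction_and _ (px _ _ _) (py _ _ _))) _;
  rewrite /= ?fsize_to_frege ?csize_dual; lia.
Qed.

Lemma provable_rule_instance E w c d :
  rule_instance SKSg c d -> 1024 * (csize c + csize d) <= w ->
  provable E w (400 * (csize c + csize d)) (to_frege c ==> to_frege d).
Proof.
(* At the variable [A] the substitution law says that the negated variable is replaced by the dual,
   which is what identity and cut require. *)
case=> {c d} a b rho sigma rule _ sigmaP; have := sigmaP (0, true).
case: rule => /= [||||||] dualE; rewrite /neg /= in dualE *; rewrite ?dualE ?csize_dual.
all: move=> hw; have a0 := csize_gt0 (sigma (0, true)).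
- apply: provable_le (provable_const _ (provable_or_dual _ _)) _;
    rewrite /= ?fsize_to_frege ?csize_dual; lia.
- by apply: provable_le (provable_and_dual _ _) _; lia.
- by apply: provable_le (provable_false _ _) _; rewrite ?fsize_to_frege; lia.
- by apply: provable_le (provable_true _ _) _; rewrite ?fsize_to_frege; lia.
- by apply: provable_le (provable_cases _ (provable_refl _ _) (provable_refl _ _)) _;
    rewrite ?fsize_to_frege; lia.
- by apply: provable_le (provable_pair _ (provable_refl _ _) (provable_refl _ _)) _;
    rewrite ?fsize_to_frege; lia.
by apply: provable_le (provable_switch _ _) _; rewrite ?fsize_to_frege; lia.
Qed.

Lemma provable_rule_step E w n a b :
  rule_step SKSg a b -> csize a <= n -> csize b <= n -> 2048 * n <= w ->
  provable E w (1000 * n ^ 3) (to_frege a ==> to_frege b).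
Proof.
case=> xi c d rule an bn hw; have hc := csize_plug xi c; have hd := csize_plug xi d.
apply: provable_le (provable_plug _ (provable_rule_instance _ rule _)) _; try lia.
have -> : n ^ 3 = n * n ^ 2 by rewrite expnS.
have : 0 < n ^ 2 by rewrite expn_gt0; have := csize_gt0 c; lia.
by nia.
Qed.

(** One modus ponens carries provability from each formula of the chain to the next; the 1001
    absorbs this extra node, as [n ^ 3] is positive. *)
Lemma provable_derivation E w n l k a s :
  alternating SKSg k (a :: s) -> all (fun b => csize b <= n) (a :: s) ->
  2048 * n <= w -> provable E w l (to_frege a) ->
  provable E w (l + size s * (1001 * n ^ 3)) (to_frege (last a s)).
Proof.
elim: s k a l => [|b s IHs] k a l alt szs hw pa; first by apply: provable_le pa _; lia.
have [an bn] : csize a <= n /\ csize b <= n by case/and3P: szs.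
have n3 : 0 < n ^ 3 by rewrite expn_gt0; have := csize_gt0 a; lia.
have [k' alt' step] : exists2 k', alternating SKSg k' (b :: s) &
    provable E w (1000 * n ^ 3) (to_frege a ==> to_frege b).
  move: alt; rewrite -[a :: _]/(a :: b :: s) => alt; inversion_clear alt.
    by exists false => //; apply: provable_ceq => //; lia.
  by exists true => //; apply: provable_rule_step.
have pb := provable_mp step pa.
apply: provable_le (IHs k' b _ alt' _ hw pb) _; first by case/andP: szs.
by rewrite /=; nia.
Qed.

(** * Extension instances and linear proofs *)

Lemma cvar_occurs_dual x a : cvar_occurs x (dual a) = cvar_occurs (neg x) a.
Proof.
elim: a => //= [y|a -> b ->|a -> b ->] //.
by case: x y => [k b] [k' b']; rewrite /neg !xpair_eqE /=; case: b b' => [] [].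
Qed.

Lemma fvar_occurs_to_frege x a :
  fvar_occurs (inr x) (to_frege a) =
  cvar_occurs (x, true) a || cvar_occurs (x, false) a.
Proof.
have inr_eq k : (inr x == inr k :> fvar) = (x == k) by apply/eqP/eqP => [[]|->].
elim: a => //= [[k []]|[k b]|a -> b ->|a -> b ->] //=.
- by rewrite !xpair_eqE; case: b; rewrite /= inr_eq andbT andbF ?orbF.
- by rewrite orbACA.
- by rewrite orbACA.
Qed.

(** The Frege variable forgets polarity, so absence of both the literal and its negation is what
    matters. *)
Lemma fresh_to_frege x a :
  cvar_fresh x a -> ~~ fvar_occurs (inr x.1) (to_frege a).
Proof.
rewrite fvar_occurs_to_frege negb_or => /andP[].
by case: x => k [] /= ? ?; apply/andP.
Qed.

Lemma fresh_dual x a : cvar_fresh x (dual a) = cvar_fresh x a.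
Proof.
rewrite /cvar_fresh !cvar_occurs_dual andbC; congr (~~ cvar_occurs _ _ && _).
by case: x => k b; rewrite /neg /= negbK.
Qed.

(* An extension variable of negative polarity is the negation of a Frege
   variable, which then abbreviates the dual formula. *)
Definition extension_body (x : literal * cform) : cform :=
  if x.1.2 then x.2 else dual x.2.

Definition extension_iff (x : literal * cform) : fform :=
  FIff (FVar (inr x.1.1)) (to_frege (extension_body x)).

Lemma fsize_extension_iff x : fsize (extension_iff x) = 2 * (csize x.2).+1.
Proof.
rewrite /= fsize_to_frege /extension_body; case: ifP => _; rewrite ?csize_dual; lia.
Qed.

Lemma fresh_extension_body x y :
  cvar_fresh x y.2 -> ~~ fvar_occurs (inr x.1) (to_frege (extension_body y)).
Proof.
by move=> fr; apply: fresh_to_frege; rewrite /extension_body; case: ifP; rewrite ?fresh_dual.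
Qed.

(** Two literals with the same name are equal or negations of each other, and both cases are
    excluded by the uniqueness hypothesis. *)
Lemma uniq_extension_names (e : seq (literal * cform)) :
  uniq (flatten [seq [:: x.1; neg x.1] | x <- e]) -> uniq [seq x.1.1 | x <- e].
Proof.
elim: e => //= x e IHe /and3P[xN nxN /IHe ->]; rewrite andbT.
apply: contra xN => /mapP[y ye xy]; rewrite inE; apply/orP; right.
apply/flatten_mapP; exists y => //; rewrite !inE.
case: x y xy {nxN ye} => [[k b] a] [[k' b'] a'] /= ->.
by rewrite /neg !xpair_eqE /= eqxx; case: b b' => [] [].
Qed.

Lemma extension_instance_nth e a i : extension_ok e a -> i < size e ->
  extension_instance (take i (map extension_iff e)) (to_frege a)
    (nth FTrue (map extension_iff e) i).
Proof.
case=> un fr fra ie; set x0 : literal * cform := ((0, true), CTrue).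
rewrite (nth_map x0) //; set x := nth x0 e i.
exists (inr x.1.1), (to_frege (extension_body x)); split=> //.
- rewrite -map_take all_map; apply/(all_nthP x0) => j; rewrite (size_takel (ltnW ie)) => ji.
  rewrite nth_take //=; have je := ltn_trans ji ie.
  have xF := fresh_extension_body (fr i j (ltnW ji) ie).
  (* The variable is absent from the earlier body, so it could only be the variable defined there;
     distinctness of names excludes this. *)
  rewrite !(negbTE xF) !orbF !orbb; apply/eqP => -[eqx].
  have := nth_uniq 0 _ _ (uniq_extension_names un); rewrite size_map => /(_ i j ie je).
  by rewrite !(nth_map x0) // -/x eqx eqxx => /esym/eqP ij; rewrite ij ltnn in ji.
- exact: fresh_extension_body (fr i i (leqnn i) ie).
exact: fresh_to_frege (fra i ie).
Qed.

Lemma csizes_big_cop b s : csizes s <= csize (big_cop b s).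
Proof.
elim: s => [|x [|y s] IHs]; rewrite ?big_cop2 ?csize_cop ?csizes_cons //; last first.
  by rewrite csizes_cons in IHs; lia.
by rewrite /= addn0.
Qed.

Lemma conjunctionE s : conjunction s = big_cop false s.
Proof. by elim: s => [|x [|y s] IHs] //; rewrite big_cop2 -IHs. Qed.

Lemma provable_conjunction E w l s :
  64 * (csizes s + 1) <= w -> (forall z, z \in s -> provable E w l (to_frege z)) ->
  provable E w (10 + size s * (l + 3)) (to_frege (conjunction s)).
Proof.
rewrite conjunctionE; elim: s => [|x [|y s] IHs] hw ps.
- by apply: provable_le (provable_FTrue _ _) _; rewrite /csizes /= in hw *; lia.
- by apply: provable_le (ps x (mem_head _ _)) _; rewrite /=; lia.
have hb := csize_big_cop false (y :: s); have x0 := csize_gt0 x.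
rewrite csizes_cons in hw.
rewrite big_cop2; apply: provable_le (provable_and _ (ps x (mem_head _ _)) (IHs _ _)) _.
- by rewrite !fsize_to_frege; lia.
- by lia.
- by move=> z zs; apply: ps; rewrite in_cons zs orbT.
by rewrite /=; lia.
Qed.

Definition extension_clauses (x : literal * cform) : seq cform :=
  [:: COr (CVar (neg x.1)) x.2; COr (dual x.2) (CVar x.1)].

(** The parameter [b'] stands for the translated dual of [b], which is not literally its Frege
    negation; hence the separate proof of [b || b']. *)
Lemma provable_iff_clauses E w l l' x b b' :
  64 * (fsize x + fsize b + fsize b' + 1) <= w ->
  provable E w l (FIff x b) -> provable E w l' (b || b') ->
  provable E w (l + 30) (~~ x || b) /\ provable E w (l + l' + 30) (b' || x).
Proof.
move=> hw hyp pb.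
have ax1 : provable E w 1 (FIff x b ==> (x ==> b)) by by_axiom.
have ax2 : provable E w 1 (FIff x b ==> (b ==> x)) by by_axiom.
have em : provable E w 12 (x || ~~ x) by apply: provable_excluded_middle; lia.
split.
  by apply: provable_le (provable_imp_or _ em (provable_mp ax1 hyp)) _ => /=; lia.
by apply: provable_le (provable_imp_or _ pb (provable_mp ax2 hyp)) _ => /=; lia.
Qed.

Lemma provable_extension_clause e w n x z :
  x \in e -> z \in extension_clauses x -> csize x.2 <= n -> 1024 * n <= w ->
  provable (map extension_iff e) w (200 * n + 100) (to_frege z).
Proof.
move=> xe; set E := map extension_iff e.
have hi : index x e < size E by rewrite size_map index_mem.
have ith : nth FTrue E (index x e) = extension_iff x.
  by rewrite (nth_map x) ?index_mem // nth_index.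
have hyp w' : fsize (extension_iff x) <= w' -> provable E w' 1 (extension_iff x).
  by move=> hx; rewrite -ith; apply: provable_hyp; rewrite ?ith.
move: (E) hyp => {xe hi ith}E hyp; rewrite fsize_extension_iff in hyp.
case: x hyp => -[k []] beta hyp /= zs bn hw; have b0 := csize_gt0 beta.
all: have emb := provable_or_dual E (w := w) (a := beta).
  have [|||p q] := provable_iff_clauses _ (hyp w _) (emb _);
    try by rewrite /extension_body /= ?fsize_to_frege ?csize_dual; lia.
  move: zs; rewrite !inE => /orP[] /eqP->.
    by apply: provable_le p _; lia.
  by apply: provable_le q _; lia.
(* For a negative literal the Frege variable abbreviates the dual of [beta], so the two clauses
   exchange roles and their disjuncts are swapped. *)
have [||||p q] := provable_iff_clauses _ (hyp w _) (provable_or_swap _ (emb _));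
  try by rewrite /extension_body /= ?fsize_to_frege ?csize_dual; lia.
move: zs; rewrite !inE => /orP[] /eqP->.
  by apply: provable_le (provable_or_swap _ q) _;
    rewrite /extension_body /= ?fsize_to_frege; lia.
by apply: provable_le (provable_or_swap _ p) _;
  rewrite /extension_body /= ?fsize_to_frege ?csize_dual; lia.
Qed.

(** * From tree-like derivations to sequences of lines *)

Definition inference_line (earlier : seq fform) (b : fform) : Prop :=
  frege_axiom b \/ modus_ponens earlier b.

Definition inferred_from (E r : seq fform) : Prop :=
  forall i, i < size r -> inference_line (E ++ take i r) (nth FTrue r i).

Definition listed (a : fform) (p : seq fform) : Prop :=
  exists2 i, i < size p & nth FTrue p i = a.

Lemma listed_cat a p q : listed a p -> listed a (p ++ q).
Proof.
by case=> i ip <-; exists i; rewrite ?size_cat ?nth_cat ?ip //; lia.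
Qed.

Lemma inferred_from_rcons E r b :
  inferred_from E r -> inference_line (E ++ r) b -> inferred_from E (rcons r b).
Proof.
move=> rE bE i; rewrite size_rcons ltnS leq_eqVlt => /orP[/eqP->|ir].
  by rewrite nth_rcons ltnn eqxx -cats1 take_size_cat.
by rewrite nth_rcons ir -cats1 takel_cat ?(ltnW ir) //; apply: rE.
Qed.

Lemma listed_modus_ponens p a b :
  listed (a ==> b) p -> listed a p -> modus_ponens p b.
Proof. by case=> j jp jE [i ip iE]; exists i, j; rewrite jE iE. Qed.

Lemma listed_rcons E r b : listed b (E ++ rcons r b).
Proof.
exists (size (E ++ r)); first by rewrite !size_cat size_rcons; lia.
by rewrite -rcons_cat nth_rcons ltnn eqxx.
Qed.

(** The lines [r] already written are threaded through the tree traversal. Hypotheses already stand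
    in [E], so a node adds at most one line. *)
Lemma provable_linearize E w l a r : provable E w l a -> inferred_from E r ->
  exists p, [/\ inferred_from E (r ++ p), listed a (E ++ r ++ p),
    size p <= l & all (fun b => fsize b <= w) p].
Proof.
move=> pa; elim: pa r => {l a}
  [a ax aw|i iE iw|l1 l2 a b pab IHab pa IHa|l l' a _ IH ll'] r rE.
- exists [:: a]; rewrite cats1 /= aw; split=> //; last exact: listed_rcons.
  by apply: inferred_from_rcons rE _; left.
- by exists [::]; rewrite cats0; split=> //; apply: listed_cat; exists i.
- have [p1 [E1 L1 S1 W1]] := IHab r rE; have [p2 [E2 L2 S2 W2]] := IHa _ E1.
  have bw : fsize b <= w by have := provable_fsize pab; rewrite /=; lia.
  exists (rcons (p1 ++ p2) b); rewrite -rcons_cat catA; split.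
  + apply: inferred_from_rcons E2 _; right.
    by apply: listed_modus_ponens L2; rewrite !catA -catA in L1 *; apply: listed_cat.
  + exact: listed_rcons.
  + by rewrite size_rcons size_cat; lia.
  by rewrite all_rcons bw all_cat W1.
have [p [Ep Lp Sp Wp]] := IH r rE; exists p; split=> //; exact: leq_trans Sp ll'.
Qed.

(** Linearization only places [a] somewhere in the list, possibly among the hypotheses. Deriving
    [a ==> a] and detaching it writes [a] as the last line, at the price of 7 + 1 lines. *)
Lemma provable_last E w l a : provable E w l a -> 12 * fsize a <= w ->
  exists r, [/\ inferred_from E r, 0 < size r, last FTrue r = a,
    size r <= l + 8 & all (fun b => fsize b <= w) r].
Proof.
move=> pa aw; have [|p [Ep Lp Sp Wp]] := provable_linearize (r := [::]) pa; first by [].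
have [q [Eq Lq Sq Wq]] := provable_linearize (provable_refl E aw) Ep.
exists (rcons (p ++ q) a); split.
- apply: inferred_from_rcons Eq _; right; apply: listed_modus_ponens Lq _.
  by rewrite catA; apply: listed_cat.
- by rewrite size_rcons.
- by rewrite last_rcons.
- by rewrite size_rcons size_cat; lia.
by rewrite all_rcons all_cat Wp Wq; lia.
Qed.

Lemma xFrege_proof_cat e a r :
  extension_ok e a -> inferred_from (map extension_iff e) r ->
  0 < size r -> last FTrue r = to_frege a ->
  xFrege_proof (to_frege a) (map extension_iff e ++ r).
Proof.
move=> eok rE r0 rlast; split.
- by rewrite size_cat; lia.
- by case: r r0 rlast {rE} => // b r _ /=; rewrite last_cat.
move=> i; rewrite size_cat size_map nth_cat take_cat size_map.
move=> ir; case: (ltnP i (size e)) => [ie|ei].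
  by apply: Or33; apply: extension_instance_nth.
by have [ax|mp] := rE (i - size e) ltac:(lia); [apply: Or31 | apply: Or32].
Qed.

(** * Size bounds and assembly *)

Lemma frege_size_le w p : all (fun b => fsize b <= w) p -> frege_size p <= size p * w.
Proof.
rewrite /frege_size; elim: p => [|b p IHp] /=; first by rewrite big_nil.
by case/andP=> bw /IHp; rewrite big_cons; lia.
Qed.

Lemma csize_derivation d a : a \in d -> csize a <= derivation_size d.
Proof.
rewrite /derivation_size; elim: d => //= b d IHd.
rewrite big_cons in_cons => /orP[/eqP->|/IHd]; lia.
Qed.

Lemma size_derivation d : size d <= derivation_size d.
Proof.
rewrite /derivation_size; elim: d => [|b d IHd] //=; rewrite big_cons.
by have := csize_gt0 b; lia.
Qed.

Lemma size_clauses e : size (flatten (map extension_clauses e)) = 2 * size e.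
Proof. by elim: e => //= x e ->; lia. Qed.

Lemma csizes_clauses e :
  csizes (flatten (map extension_clauses e)) <= csize (extension_premiss e).
Proof. by rewrite /extension_premiss conjunctionE; apply: csizes_big_cop. Qed.

(** Strict because a clause contains a literal beside [x.2]; this keeps the extension instance
    within twice the size of the premiss. *)
Lemma csize_extension_body x e : x \in e -> csize x.2 < csize (extension_premiss e).
Proof.
move=> xe; apply: leq_trans (csizes_clauses e).
have xs : COr (CVar (neg x.1)) x.2 \in flatten (map extension_clauses e).
  by apply/flatten_mapP; exists x; rewrite // mem_head.
by apply: leq_trans (csize_mem xs); rewrite /= add1n.
Qed.

(** There are at most [n] clauses, each derived from one extension instance at linear cost. *)
Lemma provable_extension_premiss e w n :
  csize (extension_premiss e) <= n -> 2048 * n <= w ->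
  provable (map extension_iff e) w (1000 * n ^ 2) (to_frege (extension_premiss e)).
Proof.
move=> en hw; have hs := csizes_clauses e.
have n0 := leq_trans (csize_gt0 _) en.
have ss := size_csizes (flatten (map extension_clauses e)).
have p := @provable_conjunction (map extension_iff e) w (200 * n + 100)
  (flatten (map extension_clauses e)).
apply: provable_le (p _ _) _; first by lia.
  move=> z /flatten_mapP[x xe zx]; apply: (provable_extension_clause xe zx); last by lia.
  exact: leq_trans (ltnW (csize_extension_body xe)) en.
by nia.
Qed.

Theorem theorem5p5 :
  exists C : nat,
    forall (n : nat) (a : cform) (d : seq cform),
      xSKSg_proof a d -> derivation_size d = n ->
      exists p : seq fform,
        [/\ xFrege_proof (to_frege a) p,
            size p <= C * n ^ 4
          & frege_size p <= C * n ^ 5].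
Proof.
(* One factor 2048 bounds the number of lines relative to [n ^ 4], the other the size of each line
   relative to [n]. *)
exists (2048 * 2048) => n a d [e eok [[k alt] dhead dlast]] dn.
case: d alt dhead dlast dn => [|b d] alt /= dhead dlast dn; first by inversion alt.
set w := 2048 * n.
have szd c : c \in b :: d -> csize c <= n by rewrite -dn; apply: csize_derivation.
have sd : (size d).+1 <= n by rewrite -dn; apply: (size_derivation (b :: d)).
have n0 : 0 < n by lia.
have bn : csize (extension_premiss e) <= n by rewrite -dhead szd ?mem_head.
have an : csize a <= n by rewrite szd // -dlast mem_last.
have := provable_extension_premiss bn (leqnn w); rewrite -dhead => pb.
have /provable_derivation := alt; move=> /(_ _ w n _ _ (leqnn w) pb).
rewrite dlast => /(_ (introT allP szd)) pa.
have [|r [rE r0 rlast rs rw]] := provable_last pa; first by rewrite fsize_to_frege; lia.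
have ew : all (fun b => fsize b <= w) (map extension_iff e).
  rewrite all_map; apply/allP => x /csize_extension_body/leq_trans/(_ bn) xn.
  have x2n : fsize (extension_iff x) <= 2 * n by rewrite fsize_extension_iff leq_mul2l.
  by apply: leq_trans x2n _; rewrite /w; lia.
(* Each extension pair contributes two clauses to the premiss, each of positive size. *)
have se : size e <= n.
  have := csizes_clauses e; have := size_csizes (flatten (map extension_clauses e)).
  by rewrite size_clauses; lia.
(* Fewer than [n] steps at a cost of order [n ^ 3] dominate the quadratic cost of the premiss, the
   extension lines and the 8 closing lines. *)
have sp : size (map extension_iff e ++ r) <= 2048 * n ^ 4.
  have n3 : 0 < n ^ 3 by rewrite expn_gt0 n0.
  have n23 : n ^ 2 <= n ^ 3 by rewrite leq_pexp2l.
  have n13 : n <= n ^ 3 by rewrite -{1}(expn1 n) leq_pexp2l.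
  rewrite size_cat size_map [n ^ 4]expnS; move: (n ^ 3) (n ^ 2) n3 n23 n13 rs => m m' *.
  by nia.
exists (map extension_iff e ++ r); split; first exact: xFrege_proof_cat.
  by apply: leq_trans sp _; rewrite leq_mul2r; apply/orP; right.
apply: leq_trans (frege_size_le (w := w) _) _; first by rewrite all_cat ew.
by apply: leq_trans (leq_mul sp (leqnn w)) _; rewrite /w mulnACA -expnSr.
Qed.
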